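(* Let $H\in\mathbb{C}[x,y]$ be a polynomial of degree $n+1$ that is regular at infinity, put $\mu=n^2$, and suppose that $H$ has $\mu$ simple, pairwise different critical values $t_1,\dots,t_\mu$, attained at critical points $(x_j,y_j)$, $H(x_j,y_j)=t_j$. Let $\omega_1,\dots,\omega_\mu$ be polynomial 1-forms on $\mathbb{C}^2$ with $\sum_{i=1}^\mu\deg\omega_i=\mu\deg H$ and such that $d\omega_1,\dots,d\omega_\mu$ generate $\Lambda^2/dH\wedge\Lambda^1$ as a complex vector space. Let $A=(a_{ij})\in\operatorname{Mat}_{\mu\times\mu}(\mathbb{C})$ be the matrix defined by $$H\,d\omega_i=dH\wedge\eta_i+\sum_{j=1}^\mu a_{ij}\,d\omega_j,\qquad \eta_i\in\Lambda^1,\ i=1,\dots,\mu,$$ and let $\mathbf v_j\in\mathbb{C}^\mu$ be the column vector whose $i$-th component is the value of the polynomial $\frac{d\omega_i}{dx\wedge dy}$ at $(x_j,y_j)$. Then $A$ is diagonalizable, its eigenvalues are the critical values of $H$, and the eigenvector corresponding to the critical value $t_j$ is $\mathbf v_j$.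
   Context: A polynomial $H\in\mathbb{C}[x,y]$ of degree $n+1$ ($n\ge 1$) is called regular at infinity if its highest homogeneous part $\widehat H$ is a product of pairwise different (pairwise non-proportional) linear factors. $\Lambda^k$ denotes the space of polynomial $k$-forms on $\mathbb{C}^2$; $\Lambda^2/dH\wedge\Lambda^1\cong\mathbb{C}[x,y]/\langle H_x,H_y\rangle$ via $Q\,dx\wedge dy\mapsto Q$, a space of dimension $\mu=n^2$, so the matrix $A$ is well defined. For a 2-form $Q\,dx\wedge dy$, $\frac{Q\,dx\wedge dy}{dx\wedge dy}$ denotes the polynomial $Q$. Degrees of forms are computed with $\deg dx=\deg dy=1$, e.g. $\deg(x^iy^j\,dx)=i+j+1$. A critical value is simple if it is attained at a single, nondegenerate critical point. *)

(* Defs.v *)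
From HB Require Import structures.
From mathcomp Require Import all_boot all_order all_algebra.
From mathcomp Require Import mpoly.
From mathcomp Require Import complex.
From mathcomp Require Import reals.

Set Implicit Arguments.
Unset Strict Implicit.
Unset Printing Implicit Defensive.

Import Order.TTheory GRing.Theory Num.Theory.
Local Open Scope ring_scope.

(* The coordinates x and y are the variables of index 0 and 1 of
   [{mpoly K[2]}]; points of the plane are pairs. *)
Notation xvar := (ord0 : 'I_2).
Notation yvar := (ord_max : 'I_2).

Section PlanePolynomials.
Variable K : fieldType.
Implicit Types (H p : {mpoly K[2]}) (a : K * K) (t : K).

Definition evalp p a : K := p.@[fun i => if i == xvar then a.1 else a.2].

(* [msize] is one more than the degree, and is 0 for the zero polynomial. *)
Definition pdeg p : nat := (msize p).-1.

Definition top_part p : {mpoly K[2]} := pihomog mdeg (pdeg p) p.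

Definition regular_at_infinity H : Prop :=
  exists l : 'I_(pdeg H) -> {mpoly K[2]},
    [/\ forall i, l i \is 1.-homog,
        forall i j, i != j -> forall c : K, l i != c *: l j
      & top_part H = \prod_i l i].

Definition critical_point H a : Prop :=
  evalp H^`M(xvar) a = 0 /\ evalp H^`M(yvar) a = 0.

Definition critical_value H t : Prop :=
  exists a, critical_point H a /\ evalp H a = t.

Definition hessian H a : 'M[K]_2 := \matrix_(i, j) evalp (H^`M(i))^`M(j) a.

Definition nondegenerate H a : Prop := \det (hessian H a) != 0.

Definition simple_critical_value H t : Prop :=
  exists a, [/\ critical_point H a, evalp H a = t, nondegenerate H a
    & forall b, critical_point H b -> evalp H b = t -> b = a].

(* The pair (P, Q) stands for P dx + Q dy. *)
Definition form1 : Type := ({mpoly K[2]} * {mpoly K[2]})%type.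

(* The polynomial Q stands for Q dx /\ dy, so that dividing a 2-form by
   dx /\ dy is the identity. *)
Definition form2 : Type := {mpoly K[2]}.

Definition d0 H : form1 := (H^`M(xvar), H^`M(yvar)).

Definition d1 (w : form1) : form2 := w.2^`M(xvar) - w.1^`M(yvar).

Definition wedge (v w : form1) : form2 := v.1 * w.2 - v.2 * w.1.

(* Since dx and dy have degree 1, the degree of a nonzero form is
   max (deg P) (deg Q) + 1, which is the larger of the two sizes; the zero form
   gets degree 0. *)
Definition deg1 (w : form1) : nat := maxn (msize w.1) (msize w.2).

(* The classes of the 2-forms [th i] span the K-vector space
   Lambda^2 / (dH /\ Lambda^1). *)
Definition generates_quotient H m (th : 'I_m -> form2) : Prop :=
  forall q : form2, exists (c : 'I_m -> K) (eta : form1),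
    q = (wedge (d0 H) eta + \sum_i c i *: (th i : {mpoly K[2]}) : {mpoly K[2]}).

End PlanePolynomials.

(* Main.v *)
(* At a critical point b of H every form dH /\ eta vanishes, so evaluating the
   relation that defines A at b shows that the vector of values of the d omega_i
   at b is an eigenvector of A for H(b). It is nonzero: otherwise every
   polynomial, 1 included, would vanish at b, as the d omega_i generate the
   quotient. Hence A, of size n^2, has the n^2 distinct eigenvalues t_j, and
   the rest is linear algebra. *)
Require Import Defs.
From HB Require Import structures.
From mathcomp Require Import all_boot all_order all_algebra.
From mathcomp Require Import mpoly.
From mathcomp Require Import complex.
From mathcomp Require Import reals.

Set Implicit Arguments.
Unset Strict Implicit.
Unset Printing Implicit Defensive.

Import Order.TTheory GRing.Theory Num.Theory.
Local Open Scope ring_scope.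

Section Eigen.
Variables (F : fieldType) (n : nat).
Implicit Type A : 'M[F]_n.

Lemma char_poly_trmx A : char_poly A^T = char_poly A.
Proof.
rewrite /char_poly -[RHS]det_tr; congr (\det _).
by apply/matrixP=> i j; rewrite !mxE eq_sym.
Qed.

Lemma eigenvalue_trmx A : eigenvalue A^T =1 eigenvalue A.
Proof. by move=> a; rewrite !eigenvalue_root_char char_poly_trmx. Qed.

(** [eigenvalue] is defined through row vectors; transposing turns [w] into one for [A^T], whose
    characteristic polynomial is that of [A]. *)
Lemma eigenvalue_col A a (w : 'cV[F]_n) :
  A *m w = a *: w -> w != 0 -> eigenvalue A a.
Proof.
move=> Aw w0; rewrite -eigenvalue_trmx; apply/eigenvalueP; exists w^T.
  by rewrite -trmx_mul Aw linearZ.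
by rewrite trmx_eq0.
Qed.

Variables (A : 'M[F]_n) (t : 'I_n -> F).
Hypotheses (t_inj : injective t) (t_eig : forall j, eigenvalue A (t j)).

(** The sum of these [n] nonzero eigenspaces is direct and sits in dimension [n], which leaves room
    only for lines that together fill the space. *)
Lemma rank_distinct_eigenspaces :
  (forall j, \rank (eigenspace A (t j)) = 1)%N
  /\ (\sum_j eigenspace A (t j) :=: 1%:M)%MS.
Proof.
have dx : mxdirect (\sum_j eigenspace A (t j)).
  by apply: mxdirect_sum_eigenspace => i j _ _; apply: t_inj.
have rk_sum : \rank (\sum_j eigenspace A (t j))%MS
    = (\sum_j \rank (eigenspace A (t j)))%N by apply/mxdirectP.
have rk_gt0 j : (1 <= \rank (eigenspace A (t j)))%N.
  by rewrite lt0n mxrank_eq0; apply: t_eig.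
(* Adding the bounds [1 <= rank] gives [n] at most the sum of the ranks, with equality exactly when
   every rank is 1. *)
have [le1 eq1] := @leqif_sum 'I_n predT _ _ _
  (fun j _ => leqif_eq (rk_gt0 j)).
rewrite sum1_card card_ord in le1 eq1.
have rkn : n = (\sum_j \rank (eigenspace A (t j)))%N.
  by apply/eqP; rewrite eqn_leq le1 -rk_sum rank_leq_row.
split=> [j|].
  by move/eqP: rkn; rewrite eq1 => /forallP/(_ j)/eqP.
by apply/eqmxP; rewrite submx1 sub1mx /row_full rk_sum -rkn eqxx.
Qed.

Lemma diagonalizable_distinct : diagonalizable A.
Proof.
apply/diagonalizablePeigen; exists (codom t).
  by rewrite map_inj_uniq ?enum_uniq.
rewrite big_map big_enum /=; exact: rank_distinct_eigenspaces.2.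
Qed.

(** One more eigenvalue would give [n + 1] independent nonzero eigenspaces in dimension [n]. *)
Lemma distinct_eigenvalues_exhaust s : eigenvalue A s -> exists j, s = t j.
Proof.
(* If [s] is none of the [t j], the family [u] adjoins it at the index [None]. *)
move=> As; case: (pickP (fun j => s == t j)) => [j /eqP ->|sNt]; first by exists j.
pose u (i : option 'I_n) := oapp t s i.
have u_inj : injective u.
  move=> [i|] [j|] //= => [/t_inj->//|/esym/eqP|/eqP]; by rewrite sNt.
have dx : mxdirect (\sum_i eigenspace A (u i)).
  by apply: mxdirect_sum_eigenspace => i j _ _; apply: u_inj.
have := rank_leq_row (\sum_i eigenspace A (u i))%MS.
rewrite (mxdirectP dx) /= leqNgt; case/negP.
(* The strict bound by [n] is read as a bound by the cardinal of [option 'I_n], a sum of ones to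
   compare termwise. *)
rewrite -[X in (X < _)%N]card_ord -card_option -sum1_card.
apply: leq_sum => -[j|] _; rewrite lt0n mxrank_eq0; [exact: t_eig|exact: As].
Qed.

End Eigen.

(* [eigenspace] consists of row vectors, hence the detour through A^T. *)
Lemma distinct_col_eigenvector (F : fieldType) n (A : 'M[F]_n) (t : 'I_n -> F)
    j (v w : 'cV[F]_n) :
    injective t -> (forall i, eigenvalue A (t i)) ->
    v != 0 -> A *m v = t j *: v -> A *m w = t j *: w ->
  exists c, w = c *: v.
Proof.
move=> t_inj t_eig v0 Av Aw.
have tr_eig i : eigenvalue A^T (t i) by rewrite eigenvalue_trmx.
have [/(_ j) rk1 _] := rank_distinct_eigenspaces t_inj tr_eig.
have sub_eig (u : 'cV[F]_n) :
    A *m u = t j *: u -> (u^T <= eigenspace A^T (t j))%MS.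
  by move=> Au; apply/eigenspaceP; rewrite -trmx_mul Au linearZ.
(* The line of [v^T] lies in an eigenspace of rank 1, so it is all of it and contains [w^T]. *)
have [_] := mxrank_leqif_eq (sub_eig v Av).
rewrite rank_rV trmx_eq0 v0 rk1 eqxx => /esym/andP[_ eig_v].
have /sub_rVP[c wT] := submx_trans (sub_eig w Aw) eig_v.
by exists c; apply: trmx_inj; rewrite wT linearZ.
Qed.

Section CriticalPoint.
Variables (K : fieldType) (H : {mpoly K[2]}) (b : K * K).
Hypothesis b_crit : critical_point H b.

Lemma evalp_wedge_d0 (eta : form1 K) : evalp (wedge (d0 H) eta) b = 0.
Proof.
case: b_crit; rewrite /evalp /wedge /d0 mevalB !mevalM => -> ->.
by rewrite !mul0r subr0.
Qed.

Lemma evalp_wedge_sum m (th : 'I_m -> form2 K) (c : 'I_m -> K)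
    (eta : form1 K) :
  evalp (wedge (d0 H) eta + \sum_i c i *: (th i : {mpoly K[2]})) b
  = \sum_i c i * evalp (th i) b.
Proof.
have := evalp_wedge_d0 eta; rewrite /evalp mevalD => ->.
by rewrite add0r rmorph_sum; apply: eq_bigr => i _; rewrite /= mevalZ.
Qed.

Lemma generates_evalp_neq0 m (th : 'I_m -> form2 K) :
  generates_quotient H th -> \col_i evalp (th i) b != 0.
Proof.
move=> gen; apply/eqP=> /colP th0.
have [c [eta def1]] := gen 1.
have : evalp 1 b = 0.
  rewrite [in LHS]def1 evalp_wedge_sum big1 // => i _.
  by have := th0 i; rewrite !mxE => ->; rewrite mulr0.
by rewrite /evalp meval1 => /eqP; rewrite oner_eq0.
Qed.

Lemma mulmx_evalp m (th : 'I_m -> form2 K) (A : 'M[K]_m)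
    (eta : 'I_m -> form1 K) :
    (forall i, H * th i = wedge (d0 H) (eta i)
       + \sum_j A i j *: (th j : {mpoly K[2]})) ->
  A *m (\col_i evalp (th i) b) = evalp H b *: \col_i evalp (th i) b.
Proof.
move=> A_def; apply/colP=> i; rewrite !mxE.
under eq_bigr do rewrite mxE.
(* Entry [i] of the product is the value at [b] of the right-hand side of relation [i], hence of
   [H * th i]. *)
rewrite -(evalp_wedge_sum _ _ (eta i)) -A_def.
by rewrite /evalp mevalM.
Qed.

End CriticalPoint.

Theorem proposition2 (R : realType) (n : nat) (n_ge1 : (1 <= n)%N)
    (H : {mpoly R[i][2]}) (degH : pdeg H = n.+1)
    (regH : regular_at_infinity H)
    (t : 'I_(n ^ 2) -> R[i]) (a : 'I_(n ^ 2) -> R[i] * R[i])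
    (t_inj : injective t)
    (t_simple : forall j, simple_critical_value H (t j))
    (a_crit : forall j, critical_point H (a j))
    (a_val : forall j, evalp H (a j) = t j)
    (omega : 'I_(n ^ 2) -> form1 R[i])
    (deg_omega : (\sum_i deg1 (omega i))%N = (n ^ 2 * pdeg H)%N)
    (gen_omega : generates_quotient H (fun i => d1 (omega i)))
    (A : 'M[R[i]]_(n ^ 2)) (eta : 'I_(n ^ 2) -> form1 R[i])
    (A_def : forall i,
       H * d1 (omega i) =
         wedge (d0 H) (eta i) + \sum_j A i j *: (d1 (omega j) : {mpoly R[i][2]}))
    (v : 'I_(n ^ 2) -> 'cV[R[i]]_(n ^ 2))
    (v_def : forall j, v j = \col_i evalp (d1 (omega i)) (a j)) :
  [/\ diagonalizable A,
      forall s : R[i], eigenvalue A s <-> critical_value H s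
    & forall j, [/\ v j != 0, A *m v j = t j *: v j
        & forall w : 'cV[R[i]]_(n ^ 2),
            A *m w = t j *: w -> exists c : R[i], w = c *: v j]].
Proof.
have v_neq0 j : v j != 0 by rewrite v_def; apply: generates_evalp_neq0 gen_omega.
have Av j : A *m v j = t j *: v j.
  by rewrite v_def -a_val; apply: mulmx_evalp A_def.
have t_eig j : eigenvalue A (t j) := eigenvalue_col (Av j) (v_neq0 j).
split=> [|s|j]; first exact: diagonalizable_distinct t_inj t_eig.
- split=> [/(distinct_eigenvalues_exhaust t_inj t_eig)[j ->]|].
    by exists (a j).
  (* The eigenvector is built from the given critical point [b] itself, without matching it with
     some [a j]. *)
  case=> b [b_crit <-].
  apply: eigenvalue_col (mulmx_evalp b_crit A_def) _.
  exact: generates_evalp_neq0 gen_omega.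
- split=> // w Aw.
  exact: distinct_col_eigenvector t_inj t_eig (v_neq0 j) (Av j) Aw.
Qed.
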